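(* Let $G$ be a Polish group and let $X$ be a Polish $G$-space. Assume that for every open neighborhood $V$ of the identity of $G$, for every $G$-invariant comeager subset $C$ of $X$ and for every non-meager subset $O$ of $X$ there are $c\in C$ and $o\in O$ so that $c \succeq_V o$ but $[c] \neq [o]$. Then $E^G_X$ is not essentially countable.
   Context: A Polish $G$-space is a Polish space $X$ together with a continuous action of $G$ on $X$. For $x\in X$, $[x]$ denotes the $G$-orbit of $x$, and $x\,E^G_X\,x'$ if and only if $[x]=[x']$. For $x,y\in X$ and an open neighborhood $V$ of $1$ in $G$, $x\succeq_V y$ (''$y$ admits a $V$-approximation from $x$'') means that there are $g_*\in G$ and a sequence $(g_n)$ in $V$ such that $g_n g_* x\to y$ as $n\to\infty$. For analytic equivalence relations $E$, $F$ on standard Borel spaces $X$, $Y$, $E\leq_B F$ means that there is a Borel map $f\colon X\to Y$ such that $x\,E\,x' \iff f(x)\,F\,f(x')$. A Borel equivalence relation is countable if each of its classes is countable. $E$ is essentially countable if $E\leq_B F$ for some countable Borel equivalence relation $F$ (on a standard Borel space). *)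

(* Defs.v *)
From HB Require Import structures.
From mathcomp Require Import all_boot all_order all_algebra.
From mathcomp Require Import all_classical all_reals all_analysis.
Set Implicit Arguments.
Unset Strict Implicit.
Unset Printing Implicit Defensive.

Local Open Scope classical_set_scope.

#[short(type="completeMetricType")]
HB.structure Definition CompleteMetric (K : numDomainType) :=
  {M of Complete M & Metric K M}.

HB.mixin Record isTopologicalGroup G & Topological G & Group G := {
  mulg_continuous : continuous (fun p : G * G => (p.1 * p.2)%g) ;
  invg_continuous : continuous (fun g : G => g^-1%g)
}.

#[short(type="topologicalGroupType")]
HB.structure Definition TopologicalGroup :=
  {G of Topological G & Group G & isTopologicalGroup G}.

Definition homeomorphic (S T : topologicalType) : Prop :=
  exists (f : S -> T) (g : T -> S),
    [/\ cancel f g, cancel g f, continuous f & continuous g].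

(* Complete metrizability is witnessed by a homeomorphic copy of T.  The
   structure completeMetricType is pointed, so Polish spaces are nonempty. *)
Definition polish (R : realType) (T : topologicalType) : Prop :=
  (exists2 D : set T, countable D & dense D) /\
  (exists M : completeMetricType R, homeomorphic T M).

Section baire_category.
Variable T : topologicalType.
Implicit Types A : set T.

Definition nowhere_dense A : Prop := interior (closure A) = set0.

Definition meager A : Prop :=
  exists2 F : nat -> set T,
    (forall n, nowhere_dense (F n)) & A = \bigcup_n F n.

Definition comeager A : Prop := meager (~` A).

End baire_category.

Section actions.
Variables (G : topologicalGroupType) (X : topologicalType).
Variable act : G -> X -> X.

Definition continuous_action : Prop :=
  [/\ forall x, act 1%g x = x,
      forall g h x, act (g * h)%g x = act g (act h x) &
      continuous (fun p : G * X => act p.1 p.2)].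

Definition act_orbit (x : X) : set X := range (fun g => act g x).

Definition orbit_equiv (x x' : X) : Prop := act_orbit x = act_orbit x'.

Definition act_invariant (C : set X) : Prop :=
  forall g x, C x -> C (act g x).

(* [V_approx V x y] is $x \succeq_V y$. *)
Definition V_approx (V : set G) (x y : X) : Prop :=
  exists (g_star : G) (g : nat -> G),
    (forall n, V (g n)) /\ (act (g n * g_star)%g x @[n --> \oo] --> y).

End actions.

Definition polish_G_space (R : realType) (G : topologicalGroupType)
    (X : topologicalType) (act : G -> X -> X) : Prop :=
  polish R X /\ continuous_action act.

Notation borelType T := (g_sigma_algebraType (@open T)).

Definition standard_borel (R : realType) d (Y : measurableType d) : Prop :=
  exists2 P : ptopologicalType, polish R P &
  exists (f : Y -> borelType P) (g : borelType P -> Y),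
    [/\ cancel f g, cancel g f,
        measurable_fun setT f & measurable_fun setT g].

Definition borel_reducible d1 d2 (X : measurableType d1)
    (Y : measurableType d2) (E : X -> X -> Prop) (F : Y -> Y -> Prop) : Prop :=
  exists2 f : X -> Y, measurable_fun setT f &
    forall x x', E x x' <-> F (f x) (f x').

Definition countable_borel_equivalence d (Y : measurableType d)
    (F : Y -> Y -> Prop) : Prop :=
  [/\ RelationClasses.Equivalence F,
      measurable [set p : Y * Y | F p.1 p.2] &
      forall y, countable [set y' | F y y']].

Definition essentially_countable (R : realType) d (X : measurableType d)
    (E : X -> X -> Prop) : Prop :=
  exists d' (Y : measurableType d') (F : Y -> Y -> Prop),
    [/\ standard_borel R Y, countable_borel_equivalence F &
        borel_reducible E F].

(* Main.v *)
Require Import Defs.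
From mathcomp Require Import all_boot all_order all_algebra.
From mathcomp Require Import all_classical all_reals all_analysis.
Set Implicit Arguments.
Unset Strict Implicit.
Unset Printing Implicit Defensive.

Import Order.TTheory GRing.Theory Num.Theory.
Local Open Scope classical_set_scope.

(** Suppose that $f$ is a Borel reduction of $E^G_X$ to a countable Borel
    equivalence relation; its values may be taken in a Polish space.  The
    function $f$ then takes countably many values on each orbit, and two points
    with the same value are in the same orbit.  The idea is that countability
    forces $f$ to be generically constant on orbits at a scale that is locally
    uniform in $X$, and that such a function cannot distinguish $x$ from $y$
    when $y$ is approximated from $x$ at that scale.

    The Borel function $f$ is continuous on a comeager set $D$
    ([borel_continuous_comeager]).  Let $C$ be the set of the points $x$ such
    that $g x \in D$ for a comeager set of $g$; it is invariant and comeager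
    ([vaught_star_invariant], [vaught_star_comeager]).  Call $x$ stable for an
    open set $V$ of $G$ if $f (g x)$ does not depend on $g \in V$ with
    $g x \in D$.

    For $x$ in $C$, the map sending $g$ to $f (g x)$ has countable range, so by
    Baire category $x$ is stable for some nonempty open set
    ([countable_image_stable]); hence an open set of translates of $x$ are
    stable for basic neighbourhoods of $1$.  Within $C$, stability for $V$ is a
    closed condition ([stable_closed]).  As $G$ has a countable base, a category
    argument yields a single open $V \ni 1$ and a nonempty open $U$ such that
    every point of $U \cap C$ is stable for $V$ ([locally_stable]).

    The hypothesis, applied to $V^{-1}$, to $C$ and to the nonmeager set
    $U \cap C$, gives $c \in C$ and $o \in U \cap C$ in different orbits with
    $g_n a c \to o$ for some $a \in G$ and $g_n \in V^{-1}$.  Stability makes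
    $f (h g_n a c)$ eventually constant in $n$ for generic $h \in V$, and
    continuity on $D$ identifies this constant with $f (h o)$
    ([approx_common_value]).  So $c$ and $o$ are in the same orbit, a
    contradiction. *)

(** * Polish spaces *)

Section polish_spaces.
Local Open Scope ring_scope.

Definition baire_space (T : topologicalType) : Prop :=
  forall F : nat -> set T,
    (forall n, open (F n)) -> (forall n, dense (F n)) ->
    dense (\bigcap_n F n).

(** The usual nested-ball construction.  Closed balls are avoided: each new
    ball is required to stay inside the previous one even after its radius is
    doubled, so a limit of centres, being within one radius of the later
    centres, remains in every doubled ball. *)
Lemma complete_baire (R : realType) (M : completePseudoMetricType R) :
  baire_space M.
Proof.
move=> F oF dF D D0 oD.
have shrink (n : nat) (p : M * {posnum R}) (A : set M) :
    A `&` (ball p.1 p.2%:num)° !=set0 -> open A -> exists q : M * {posnum R},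
    ball q.1 (q.2%:num * 2) `<=` A `&` ball p.1 p.2%:num
    /\ (q.2%:num <= n.+1%:R^-1).
  move=> [b [Ab pb]] oA.
  have /nbhs_ballP[_/posnumP[e] eA] : nbhs b (A `&` ball p.1 p.2%:num).
    by apply: filterI; [exact: open_nbhs_nbhs | exact: pb].
  have r0 : (0 < Num.min (e%:num / 2) n.+1%:R^-1 :> R).
    by rewrite lt_min divr_gt0//= invr_gt0 ltr0n.
  exists (b, PosNum r0) => /=; split; last by rewrite ge_min lexx orbT.
  apply: subset_trans eA; apply: le_ball.
  by rewrite -ler_pdivlMr// ge_min lexx.
have step (np : nat * (M * {posnum R})) : exists q : M * {posnum R},
    ball q.1 (q.2%:num * 2) `<=` F np.1 `&` ball np.2.1 np.2.2%:num
    /\ (q.2%:num <= np.1.+2%:R^-1).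
  case: np => n p; apply: shrink; last exact: oF.
  rewrite setIC; apply: dF; last exact: open_interior.
  by exists p.1; exact: nbhsx_ballx.
have [next nextP] := choice step.
have [p0 [p0D p01]] : exists q : M * {posnum R},
    ball q.1 (q.2%:num * 2) `<=` D /\ (q.2%:num <= 1).
  have [d Dd] := D0.
  have [|q [qD q1]] := @shrink 0%N (d, PosNum (@ltr01 R)) D _ oD.
    by exists d; split=> //; exact: nbhsx_ballx.
  by exists q; split; [move=> x /qD[] | rewrite invr1 in q1].
pose fix p n := if n is m.+1 then next (m, p m) else p0.
have pS n : ball (p n.+1).1 ((p n.+1).2%:num * 2) `<=`
    F n `&` ball (p n).1 (p n).2%:num by have [] := nextP (n, p n).
have pr n : ((p n).2%:num <= n.+1%:R^-1).
  by case: n => [|n]; [rewrite invr1 | have [] := nextP (n, p n)].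
have sub2 n : ball (p n).1 (p n).2%:num `<=` ball (p n).1 ((p n).2%:num * 2).
  by apply: le_ball; rewrite ler_peMr// ler1n.
have nested n m : (n <= m)%N -> ball (p n).1 (p n).2%:num (p m).1.
  move=> /subnK <-; elim: (m - n)%N => [|k IHk]; first exact: ballxx.
  suff sub j : ball (p (j + n)%N).1 (p (j + n)%N).2%:num
      `<=` ball (p n).1 (p n).2%:num by apply: sub; exact: ballxx.
  by elim: j => [//|j IHj] x /sub2; rewrite addSn => /pS[_ /IHj].
have : cvg ((fun n => (p n).1) @ \oo).
  apply: cauchy_cvg; apply: cauchy_exP => e e0.
  have [n ne] : exists n, (n.+1%:R^-1 < e).
    exists (Num.truncn e^-1).
    by rewrite -ltf_pV2 ?posrE ?divr_gt0// invrK truncnS_gt.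
  exists (p n).1, n => // m /= nm.
  by apply: le_ball (nested _ _ nm); exact: (le_trans (pr n) (ltW ne)).
move=> /cvg_ex[l pl].
have lin n : ball (p n).1 ((p n).2%:num * 2) l.
  have /cvg_ball/(_ (p n).2%:num) [//|N _ /(_ (maxn N n)) /=] := pl.
  rewrite leq_maxl => /(_ isT)/ball_sym lN.
  rewrite mulr_natr mulr2n; apply: ball_triangle lN.
  by apply: nested; exact: leq_maxr.
by exists l; split; [exact: p0D (lin 0%N) | move=> n _; case/pS: (lin n.+1)].
Qed.

Lemma dense_preimage (S T : topologicalType) (f : S -> T) (g : T -> S)
    (A : set T) :
  cancel g f -> cancel f g -> continuous g -> dense A -> dense (f @^-1` A).
Proof.
move=> gf fg cg dA O [x Ox] oO.
have [y [Oy Ay]] : (g @^-1` O) `&` A !=set0.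
  apply: dA; first by exists (f x); rewrite /preimage/= fg.
  by apply: open_comp => // y _; exact: cg.
by exists (g y); split => //; rewrite /preimage/= gf.
Qed.

Lemma polish_baire (R : realType) (T : topologicalType) :
  polish R T -> baire_space T.
Proof.
move=> [_ [M [f [g [fg gf cf cg]]]]] F oF dF.
suff : dense (f @^-1` (\bigcap_n (g @^-1` F n))).
  rewrite preimage_bigcap; congr dense; apply: eq_bigcapr => n _.
  by apply/funext => x; rewrite /preimage/= fg.
apply: (dense_preimage gf fg cg); apply: complete_baire => n.
  by apply: open_comp => // y _; exact: cg.
exact: (dense_preimage fg gf cf).
Qed.

(** A base indexed by [nat], because unions and intersections in the Baire
    category arguments are taken over [nat]; some members may be empty. *)
Definition open_base (T : topologicalType) (B : nat -> set T) : Prop :=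
  (forall n, open (B n)) /\
  forall x A, nbhs x A -> exists2 n, B n x & B n `<=` A.

(** The balls of radius [1 / n.+1] around the points of a countable dense set,
    pulled back along the homeomorphism with a metric space. *)
Lemma polish_countable_base (R : realType) (T : topologicalType) :
  polish R T -> exists B : nat -> set T, open_base B.
Proof.
move=> [[D /countable_injP[code inj] dD] [M [f [g [fg gf cf cg]]]]].
pose B (p : nat * nat) := \bigcup_(d in [set d | D d /\ code d = p.1])
   (f @^-1` (ball (f d) (p.2.+1%:R^-1))°).
have oB p : open (B p).
  apply: bigcup_open => d _; apply: open_comp => [y _|]; first exact: cf.
  exact: open_interior.
have BP x A : nbhs x A -> exists2 p, B p x & B p `<=` A.
  move=> nA.
  have /nbhs_ballP[_/posnumP[e] eA] : nbhs (f x) (g @^-1` A).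
    by apply: cg; rewrite fg.
  have [n ne] : exists n, (n.+1%:R^-1 < e%:num / 2).
    exists (Num.truncn (e%:num / 2)^-1).
    by rewrite -ltf_pV2 ?posrE ?divr_gt0// invrK truncnS_gt.
  (* Half the radius of the basic ball, so that a centre found near x
     has x in the interior of its own ball. *)
  have n0 : (0 < n.+1%:R^-1 / 2 :> R) by rewrite divr_gt0// invr_gt0 ltr0n.
  have [d [/= xd Dd]] :
      (f @^-1` (ball (f x) (n.+1%:R^-1 / 2))°) `&` D !=set0.
    apply: dD; first by exists x; exact: (nbhsx_ballx _ _ n0).
    apply: open_comp => [y _|]; first exact: cf.
    exact: open_interior.
  have {}xd := interior_subset xd.
  exists (code d, n).
    exists d => //; rewrite /preimage/= /interior; apply/nbhs_ballP.
    exists (n.+1%:R^-1 / 2) => //= y xy.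
    by rewrite (splitr n.+1%:R^-1); apply: ball_triangle xy; exact: ball_sym.
  move=> y [d' [Dd' dd']].
  have {dd' Dd'}-> : d' = d by apply: inj dd'; rewrite inE.
  rewrite /preimage/= => /interior_subset dy.
  rewrite -(fg y); apply: eA; rewrite (splitr e%:num).
  have r2 : (n.+1%:R^-1 / 2 <= n.+1%:R^-1 :> R).
    by rewrite ler_pdivrMr// ler_peMr ?invr_ge0// ler1n.
  apply: (@ball_triangle _ _ (f d)).
    by apply: le_ball xd; exact: (le_trans r2 (ltW ne)).
  by apply: le_ball dy; exact: ltW.
exists (fun n => oapp B set0 (unpickle n)); split.
  by move=> n; case: unpickle => [p|] /=; [exact: oB | exact: open0].
move=> x A /BP[p px pA]; exists (pickle p); rewrite pickleK //.
Qed.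

Lemma polish_hausdorff (R : realType) (T : topologicalType) :
  polish R T -> hausdorff_space T.
Proof.
move=> [_ [M [f [g [fg _ cf _]]]]].
have := @metric_hausdorff R M; rewrite !open_hausdorff => hausM x y xy.
have [|[A B] /= [/set_mem Ax /set_mem By] [oA oB /eqP AB0]] := hausM (f x) (f y).
  by apply: contra_neq xy => /(congr1 g); rewrite !fg.
exists (f @^-1` A, f @^-1` B) => /=; first by rewrite !inE.
split; [by apply: open_comp | by apply: open_comp |].
by rewrite -preimage_setI AB0 preimage_set0.
Qed.

End polish_spaces.

(** * Baire category *)

Section category.
Variable T : topologicalType.
Implicit Types A B : set T.

(** Complements of closures of nowhere dense sets are open and dense.  In this
    form comeager sets are easy to intersect and to pull back. *)
Lemma comeagerP A : comeager A <->
  exists F : nat -> set T, [/\ forall n, open (F n), forall n, dense (F n)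
    & \bigcap_n F n `<=` A].
Proof.
split=> [[F ndF AF]|[F [oF dF FA]]].
  exists (fun n => ~` closure (F n)); split => [n|n|x xF].
  - by apply: closed_openC; exact: closed_closure.
  - move=> O O0 oO; apply: contrapT => /set0P/negP/negPn/eqP OF.
    have : O `<=` interior (closure (F n)).
      rewrite -open_subsetE// => x Ox; apply: contrapT => nx.
      by have : set0 x by rewrite -OF.
    by rewrite ndF subset0 => O00; case: O0 => x; rewrite O00.
  - apply: contrapT => Ax; have : (~` A) x by [].
    by rewrite AF => -[n _ Fnx]; exact: xF n I (subset_closure Fnx).
(* The union must be exactly ~` A, hence the intersection. *)
exists (fun n => ~` F n `&` ~` A).
  move=> n; rewrite /nowhere_dense -subset0 => x xF.
  have [] : interior (closure (~` F n `&` ~` A)) `&` F n !=set0.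
    by apply: dF; [exists x | exact: open_interior].
  move=> y [/interior_subset yF Fy].
  have : closure (~` F n) y by apply: closure_subset yF; exact: subIsetl.
  by rewrite -(closure_id _).1//; exact: open_closedC.
apply/seteqP; split=> [x Ax|x [n _ []]//].
apply: contrapT => xF; apply: (Ax); apply: FA => n _.
by apply: contrapT => nFx; apply: xF; exists n.
Qed.

Lemma comeager_sub A B : A `<=` B -> comeager A -> comeager B.
Proof.
move=> AB /comeagerP[F [oF dF FA]]; apply/comeagerP; exists F; split => //.
exact: subset_trans AB.
Qed.

Lemma open_dense_comeager A : open A -> dense A -> comeager A.
Proof.
move=> oA dA; apply/comeagerP; exists (fun=> A); split=> // x Ax.
exact: (Ax 0%N I).
Qed.

Lemma comeager_bigcap (A : nat -> set T) :
  (forall n, comeager (A n)) -> comeager (\bigcap_n A n).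
Proof.
move=> cA; apply/comeagerP.
have [F FP] := choice (fun n => (comeagerP (A n)).1 (cA n)).
exists (fun k => oapp (fun p : nat * nat => F p.1 p.2) setT (unpickle k)).
split=> [k|k|x Fx n _].
- by case: unpickle => [[i j]|] /=; [case: (FP i) | exact: openT].
- case: unpickle => [[i j]|] /=; first by case: (FP i).
  by move=> O O0 _; rewrite setIT.
- have [_ _] := FP n; apply => m _.
  by have := Fx (pickle (n, m)) I; rewrite /= pickleK.
Qed.

Lemma comeagerI A B : comeager A -> comeager B -> comeager (A `&` B).
Proof.
move=> cA cB;
  apply: comeager_sub (_ : comeager (\bigcap_n if n is 0 then A else B)).
  by move=> x AB; split; [exact: AB 0%N I | exact: AB 1%N I].
by apply: comeager_bigcap => -[].
Qed.

Lemma comeager_dense A : baire_space T -> comeager A -> dense A.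
Proof.
move=> bT /comeagerP[F [oF dF FA]] O O0 oO.
by have [x [Ox /FA Ax]] := bT F oF dF O O0 oO; exists x.
Qed.

Lemma open_nonmeager A B : baire_space T -> open A -> A !=set0 ->
  comeager B -> ~ meager (A `&` B).
Proof.
move=> bT oA A0 cB mAB.
have cAB : comeager (~` (A `&` B)) by rewrite /comeager setCK.
have [x [Ax [nAB Bx]]] := comeager_dense bT (comeagerI cAB cB) A0 oA.
exact: nAB.
Qed.

(** Applied to the level sets of a function with countable range, this finds a
    value taken on a dense subset of an open set. *)
Lemma somewhere_dense_piece (A : nat -> set T) B : baire_space T ->
  comeager B -> B `<=` \bigcup_n A n -> [set: T] !=set0 ->
  exists n, interior (closure (A n)) !=set0.
Proof.
move=> bT cB BA T0; apply: contrapT => /forallNP ndA.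
have cA : comeager (\bigcap_n ~` A n).
  exists A; last by rewrite setC_bigcap; apply: eq_bigcupr => n _; rewrite setCK.
  by move=> n; apply/eqP/negPn/negP => /set0P; exact: ndA.
have [x [_ [Ax /BA[n _]]]] := comeager_dense bT (comeagerI cA cB) T0 openT.
exact: Ax.
Qed.

End category.

Lemma comeager_preimage (S T : topologicalType) (f : S -> T) (g : T -> S)
    (A : set T) :
  cancel g f -> cancel f g -> continuous f -> continuous g ->
  comeager A -> comeager (f @^-1` A).
Proof.
move=> gf fg cf cg /comeagerP[F [oF dF FA]]; apply/comeagerP.
exists (fun n => f @^-1` F n); split=> [n|n|x Fx].
- by apply: open_comp => // y _; exact: cf.
- exact: (dense_preimage gf fg cg).
- by apply: FA => n _; exact: Fx.
Qed.

Definition baire_property (T : topologicalType) (A : set T) : Prop :=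
  exists2 U, open U & comeager [set x | A x <-> U x].

(** The sets with the Baire property form a sigma-algebra containing the open
    sets.  For complements, an open set together with the interior of its
    complement is open dense, which lets a closed set be replaced by its
    interior. *)
Lemma borel_baire_property (T : ptopologicalType) (A : set (borelType T)) :
  measurable A -> baire_property (A : set T).
Proof.
apply: smallest_sub => [|U oU]; last first.
  exists U => //; apply: comeager_sub (open_dense_comeager openT _) => // O O0 _.
  by rewrite setIT.
split.
- exists set0; first exact: open0.
  apply: comeager_sub (open_dense_comeager openT _) => // O O0 _.
  by rewrite setIT.
- move=> B [U oU BU]; exists (interior (~` U)); first exact: open_interior.
  have bd : comeager (U `|` interior (~` U)).
    apply: open_dense_comeager.
      by apply: openU => //; exact: open_interior.
    move=> O [y Oy] oO; apply: contrapT => /forallNP no.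
    have OU : O `<=` interior (~` U).
      rewrite -open_subsetE// => z Oz Uz; apply: (no z).
      by split => //; left.
    by apply: (no y); split=> //; right; exact: OU.
  apply: comeager_sub (comeagerI BU bd) => x [/= BUx bx].
  split=> [[_ Bx]|/interior_subset Ux]; last by split=> // /BUx.
  by case: bx => // /BUx.
- move=> F FB; have [U UP] := choice (fun n => (exists2P _ _).1 (FB n)).
  exists (\bigcup_n U n).
    by apply: bigcup_open => n _; have [] := UP n.
  apply: comeager_sub (comeager_bigcap (fun n => (UP n).2)) => x /= FU.
  by split=> -[n _ /FU Fx]; exists n => //; exact: Fx.
Qed.

(** * Continuity on a comeager set *)

Lemma within_continuous_open (X Y : topologicalType) (D : set X) (f : X -> Y)
    (W : set Y) :
  {within D, continuous f} -> open W ->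
  exists2 U, open U & forall x, D x -> U x <-> W (f x).
Proof.
move=> /continuousP fD /fD /open_subspaceP[U oU UW]; exists U => // x Dx.
split=> [Ux|Wx].
  have : (U `&` D) x by [].
  by rewrite UW => -[].
have : (f @^-1` W `&` D) x by [].
by rewrite -UW => -[].
Qed.

(** The preimage of each basic open set agrees with an open set off a meager
    set; discarding these countably many meager sets makes every one of these
    preimages relatively open. *)
Lemma borel_continuous_comeager (X P : ptopologicalType) (B : nat -> set P)
    (f : borelType X -> borelType P) :
  open_base B ->
  measurable_fun setT f ->
  exists2 D : set X, comeager D & {within D, continuous (f : X -> P)}.
Proof.
move=> [oB baseB] mf.
have bpB n : baire_property (f @^-1` B n : set X).
  apply: borel_baire_property; rewrite -[X in measurable X]setTI.
  by apply: mf => //; exact: sub_sigma_algebra.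
have [U UP] := choice (fun n => (exists2P _ _).1 (bpB n)).
exists (\bigcap_n [set x : X | B n (f x) <-> U n x]).
  by apply: comeager_bigcap => n; have [] := UP n.
apply/continuousP => W oW; apply/open_subspaceP.
exists (\bigcup_(n in [set n | B n `<=` W]) U n).
  by apply: bigcup_open => n _; have [] := UP n.
apply/seteqP; split=> x [].
  by move=> [n BW Unx] xD; split=> //; apply: BW; exact/(xD n I).
move=> Wx xD; split=> //.
have [n Bnx BW] := baseB _ _ (open_nbhs_nbhs (conj oW Wx)).
by exists n => //; exact/(xD n I).
Qed.

(** * Generic translates *)

Section group_actions.
Variables (G : topologicalGroupType) (X : topologicalType) (act : G -> X -> X).
Hypothesis act_cont : continuous_action act.

Let act1 x : act 1%g x = x. Proof. by case: act_cont. Qed.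
Let actM g h x : act (g * h)%g x = act g (act h x).
Proof. by case: act_cont. Qed.

Lemma continuous_act g : continuous (act g).
Proof.
case: act_cont => _ _ cact x.
have gx : (g, y) @[y --> x] --> (g, x).
  by apply: cvg_pair => //; exact: cvg_cst.
exact: cvg_comp gx (cact (g, x)).
Qed.

Lemma continuous_orbit_map x : continuous (act ^~ x).
Proof.
case: act_cont => _ _ cact g.
have gx : (h, x) @[h --> g] --> (g, x).
  by apply: cvg_pair => //; exact: cvg_cst.
exact: cvg_comp gx (cact (g, x)).
Qed.

Lemma continuous_mulgr (h : G) : continuous (fun g : G => (g * h)%g).
Proof.
move=> g.
have gh : (k, h) @[k --> g] --> (g, h).
  by apply: cvg_pair => //; exact: cvg_cst.
exact: cvg_comp gh (@mulg_continuous G (g, h)).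
Qed.

Lemma actK g : cancel (act g) (act g^-1%g).
Proof. by move=> x; rewrite -actM mulVg act1. Qed.

Lemma actKV g : cancel (act g^-1%g) (act g).
Proof. by move=> x; rewrite -actM mulgV act1. Qed.

Lemma orbit_equivP x y : orbit_equiv act x y <-> exists g, y = act g x.
Proof.
split=> [xy|[g ->]].
  have : act_orbit act y y by exists 1%g.
  by rewrite -xy => -[g _ <-]; exists g.
apply/seteqP; split=> _ [h _ <-].
  by exists (h * g^-1)%g => //; rewrite actM actK.
by exists (h * g)%g => //; rewrite actM.
Qed.

(** The Vaught transform, usually written $D^*$: the points almost all of whose
    translates lie in [D].  It replaces a comeager set by an invariant one. *)
Definition vaught_star (D : set X) : set X :=
  [set x | comeager [set g | D (act g x)]].

(** Right translation is a homeomorphism of [G], so it preserves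
    comeagerness. *)
Lemma vaught_star_invariant D : act_invariant act (vaught_star D).
Proof.
move=> h x Dx; rewrite /vaught_star/=.
have -> : [set g | D (act g (act h x))]
    = (fun g => (g * h)%g) @^-1` [set g | D (act g x)].
  by apply/seteqP; split=> g; rewrite /preimage/= actM.
apply: (comeager_preimage (mulgVK h) (mulgK h)) => //;
  exact: continuous_mulgr.
Qed.

(** The easy half of a Kuratowski-Ulam argument.  For [F] open dense in [X] and
    [B] a nonempty basic open set of [G], the points that some element of [B]
    moves into [F] form an open dense set.  A point in all of these countably
    many sets has, for each [F], an open dense set of [g] moving it
    into [F]. *)
Lemma vaught_star_comeager D (B : nat -> set G) :
  open_base B ->
  comeager D -> comeager (vaught_star D).
Proof.
move=> [oB baseB] /comeagerP[F [oF dF FD]].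
pose meets n k := [set x | B k = set0 \/ exists2 g, B k g & F n (act g x)].
have cmeets n k : comeager (meets n k).
  have [Bk0|/set0P[g Bkg]] := eqVneq (B k) set0.
    apply: comeager_sub (open_dense_comeager openT _) => [x _|O O0 _].
      by left.
    by rewrite setIT.
  have oE : open (\bigcup_(h in B k) (act h @^-1` F n)).
    apply: bigcup_open => h _; apply: open_comp => // y _.
    exact: continuous_act.
  apply: comeager_sub (open_dense_comeager oE _) => [x [h]|O O0 oO].
    by move=> Bkh Fhx; right; exists h.
  have [|x [Ox Fgx]] := dense_preimage (@actKV g) (@actK g)
    (@continuous_act g^-1%g) (dF n) O0 _; first exact: oO.
  by exists x; split=> //; exists g.
have := comeager_bigcap (fun n => comeager_bigcap (cmeets n)).
apply: comeager_sub => x xM; apply/comeagerP.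
exists (fun n => [set g | F n (act g x)]); split=> [n|n|g gF].
- by apply: (@open_comp _ _ (act ^~ x)) => // g _; exact: continuous_orbit_map.
- move=> O [g Og] oO.
  have [k Bkg BO] := baseB _ _ (open_nbhs_nbhs (conj oO Og)).
  have [Bk0|[h Bkh Fhx]] := xM n I k I; first by rewrite Bk0 in Bkg.
  by exists h; split=> //; exact: BO.
- by apply: FD => n _; exact: gF.
Qed.

(** * Stability of the reduction along small translates *)

Section stability.
Variables (P : topologicalType) (f : X -> P) (D : set X).
Hypotheses (hausP : hausdorff_space P) (fD : {within D, continuous f}).
Hypothesis baireG : baire_space G.

Local Notation C := (vaught_star D).

(** On a point of [vaught_star D], this says that [g |-> f (g x)] is constant
    almost everywhere on [V].  Quantifying over the [g] with [g x] in [D],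
    where [f] is continuous, instead of over a comeager set of [g], is what
    makes it a closed condition. *)
Definition stable (V : set G) (x : X) : Prop :=
  forall g h, V g -> V h -> D (act g x) -> D (act h x) ->
    f (act g x) = f (act h x).

Lemma generic_translate x (V : set G) g : C x -> open V -> V g ->
  exists2 h, V h & D (act h x).
Proof.
move=> Cx oV Vg.
have [|h [Vh Dh]] := comeager_dense baireG Cx _ oV; first by exists g.
by exists h.
Qed.

Lemma within_separated x y : D x -> D y -> f x <> f y ->
  exists U V, [/\ open U, open V, U x, V y &
    forall a b, D a -> D b -> U a -> V b -> f a <> f b].
Proof.
move=> Dx Dy /eqP; move: hausP; rewrite open_hausdorff => /[apply].
move=> [[A B] /= [/set_mem Ax /set_mem By] [oA oB /eqP AB0]].
have [U oU UA] := within_continuous_open fD oA.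
have [V oV VB] := within_continuous_open fD oB.
exists U, V; split=> //; [exact/UA | exact/VB |].
move=> a b Da Db /(UA a Da) Aa /(VB b Db) Bb ab.
suff : set0 (f a) by [].
by rewrite -AB0; split=> //; rewrite ab.
Qed.

(** If two translates of [x] have different values, they have neighbourhoods
    such that [f] never takes the same value at a point of [D] in one and at a
    point of [D] in the other.  The same two group elements move a point [y]
    near [x] into these neighbourhoods, and generic elements close to them move
    [y] into [D] as well, so [y] is not stable either. *)
Lemma stable_closed (V : set G) : open V ->
  closure (stable V `&` C) `&` C `<=` stable V.
Proof.
move=> oV x [clx Cx] g h Vg Vh Dg Dh; apply: contrapT => fgh.
have [U [W [oU oW Ug Wh UW]]] := within_separated Dg Dh fgh.
have [y [[Sy Cy] [/= Uy Wy]]] :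
    (stable V `&` C) `&` (act g @^-1` U `&` act h @^-1` W) !=set0.
  apply: clx; apply: filterI; apply: open_nbhs_nbhs; split=> //;
    by apply: open_comp => // z _; exact: continuous_act.
have translates (O : set X) k : open O -> V k -> O (act k y) ->
    exists k', [/\ V k', O (act k' y) & D (act k' y)].
  move=> oO Vk Ok.
  have oVO : open (V `&` (act ^~ y) @^-1` O).
    apply: openI => //; apply: (@open_comp _ _ (act ^~ y)) => // l _.
    exact: continuous_orbit_map.
  have [k' [Vk' Ok'] Dk'] := generic_translate Cy oVO (conj Vk Ok).
  by exists k'.
have [a [Va Ua Da]] := translates U g oU Vg Uy.
have [b [Vb Wb Db]] := translates W h oW Vh Wy.
exact: UW Da Db Ua Wb (Sy _ _ Va Vb Da Db).
Qed.

(** Some value is taken on a somewhere dense set of [g], by the Baire category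
    theorem; by continuity on [D] it is then the value at every [g] of the
    corresponding open set with [g x] in [D]. *)
Lemma countable_image_stable x :
  C x -> countable (range (fun g => f (act g x))) ->
  exists2 V, open V /\ V !=set0 & stable V x.
Proof.
move=> Cx /countable_injP[code inj].
pose A n := [set g | D (act g x) /\ code (f (act g x)) = n].
have [||n A0] := @somewhere_dense_piece G A _ baireG Cx.
- by move=> g Dg; exists (code (f (act g x))).
- by exists 1%g.
exists (interior (closure (A n))); first by split=> //; exact: open_interior.
move=> g h /interior_subset Ag /interior_subset Ah Dg Dh.
apply: contrapT => fgh.
have [U [W [oU oW Ug Wh UW]]] := within_separated Dg Dh fgh.
have near_value (O : set X) k : open O -> closure (A n) k -> O (act k x) ->
    exists2 k', A n k' & O (act k' x).
  move=> oO Ak Ok; have [|k' [Ak' Ok']] := Ak ((act ^~ x) @^-1` O).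
    apply: open_nbhs_nbhs; split=> //.
    apply: (@open_comp _ _ (act ^~ x)) => // l _.
    exact: continuous_orbit_map.
  by exists k'.
have [a [Da an] Ua] := near_value U g oU Ag Ug.
have [b [Db bn] Wb] := near_value W h oW Ah Wh.
apply: UW Da Db Ua Wb _; apply: inj; rewrite ?an ?bn//.
  by rewrite inE; exists a.
by rewrite inE; exists b.
Qed.

(** Every point of the comeager set [C] has, for an open set of [g], a translate
    [g x] that is stable for some basic neighbourhood of 1, since right
    translation turns stability on an open set containing [g] into stability
    near 1.  So the countably many sets of points of [C] stable for a given
    basic neighbourhood cannot all be nowhere dense, and one that is somewhere
    dense fills an open set up to [C], being relatively closed. *)
Lemma locally_stable (B : nat -> set G) :
  open_base B -> baire_space X -> [set: X] !=set0 -> comeager D ->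
  (forall x, countable (range (fun g => f (act g x)))) ->
  exists V U, [/\ open V, V 1%g, open U, U !=set0 & U `&` C `<=` stable V].
Proof.
move=> bB baireX X0 cD cnt; have [oB baseB] := bB.
pose S n := [set x | [/\ B n 1%g, stable (B n) x & C x]].
suff [n [y Uy]] : exists n, interior (closure (S n)) !=set0.
  have [z [[Bn1 _ _] _]] := interior_subset Uy setT filterT.
  exists (B n), (interior (closure (S n))); split=> //.
  - exact: open_interior.
  - by exists y.
  - apply: subset_trans (stable_closed (oB n)); apply: setSI.
    apply: subset_trans (@interior_subset _ _) _; apply: closure_subset.
    by move=> x [].
apply: contrapT => /forallNP ndS.
have cZ : comeager (\bigcap_n ~` S n).
  exists S; last by rewrite setC_bigcap; apply: eq_bigcupr => n _; rewrite setCK.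
  by move=> n; apply/eqP/negPn/negP => /set0P; exact: ndS.
have cC := vaught_star_comeager bB cD.
(* Otherwise a generic point has generic translates outside all S n, while an
   open set of its translates meets them. *)
have cZ' := vaught_star_comeager bB cZ.
have [x [_ [Cx Zx]]] :=
  comeager_dense baireX (comeagerI cC cZ') X0 openT.
have [V [oV V0] Vx] := countable_image_stable Cx (cnt x).
have [g [Vg Zg]] := comeager_dense baireG Zx V0 oV.
have nV : nbhs 1%g ((fun h => (h * g)%g) @^-1` V).
  apply: open_nbhs_nbhs; split; last by rewrite /preimage/= mul1g.
  by apply: open_comp => // h _; exact: continuous_mulgr.
have [n Bn1 BnV] := baseB _ _ nV.
apply: (Zg n I); split=> //; last exact: vaught_star_invariant.
move=> h k /BnV Vh /BnV Vk; rewrite -!actM; exact: Vx.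
Qed.

(** Write $z_n = g_n a c$.  Both $V g_n$ and $V g_N$ contain 1 because $g_n$ and
    $g_N$ lie in $V^{-1}$, so a generic translate of $a c$ by an element near 1
    is at once a [V]-translate of $z_n$ and of $z_N$.  By stability at these
    two points, all the $f (h z_n)$ with $n \geq N$ are equal, for a generic
    $h$ in [V].  Since $h z_n$ tends to $h o$ inside [D], continuity gives
    $f (h o)$ the same value. *)
Lemma approx_common_value (V : set G) (U : set X) c o :
  open V -> V 1%g -> open U -> U `&` C `<=` stable V ->
  C c -> C o -> U o -> V_approx act [set g | V g^-1%g] c o ->
  exists g h, f (act g c) = f (act h o).
Proof.
move=> oV V1 oU UCV Cc Co Uo [a [g [Vg go]]].
pose z n := act (g n * a)%g c.
have Cz n : C (z n) by exact: vaught_star_invariant.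
have [N _ NU] : \forall n \near \oo, U (z n).
  by apply: go; exact: open_nbhs_nbhs.
have Sz n : (N <= n)%N -> stable V (z n).
  by move=> Nn; apply: UCV; split; [exact: NU | exact: Cz].
have [h [Vh [Dho Dhz]]] : V `&` ([set h | D (act h o)] `&`
    \bigcap_n [set h | D (act h (z n))]) !=set0.
  apply: (comeager_dense baireG) => //; last by exists 1%g.
  by apply: comeagerI => //; apply: comeager_bigcap => n; exact: Cz.
have constant n : (N <= n)%N -> f (act h (z n)) = f (act h (z N)).
  move=> Nn.
  pose O := (fun k => (k * (g n)^-1)%g) @^-1` V `&`
            (fun k => (k * (g N)^-1)%g) @^-1` V.
  have oO : open O.
    by apply: openI; apply: open_comp => // k _; exact: continuous_mulgr.
  have O1 : O 1%g by split; rewrite /preimage/= mul1g; exact: Vg.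
  have Cac : C (act a c) by exact: vaught_star_invariant.
  have [k [Vkn VkN] Dk] := generic_translate Cac oO O1.
  have kz m : act k (act a c) = act (k * (g m)^-1)%g (z m).
    by rewrite /z -!actM mulgA mulgVK.
  rewrite (Sz n Nn h _ Vh Vkn (Dhz n I)); last by rewrite -kz.
  rewrite (Sz N (leqnn N) h _ Vh VkN (Dhz N I)); last by rewrite -kz.
  by rewrite -!kz.
exists (h * (g N * a))%g, h; rewrite actM -/(z N); apply: contrapT => /nesym fho.
have [W [W' [oW _ Wo W'z WW']]] := within_separated Dho (Dhz N I) fho.
have hzo : act h (z n) @[n --> \oo] --> act h o.
  by apply: cvg_comp go _; exact: continuous_act.
have [M _ MW] : \forall n \near \oo, W (act h (z n)).
  by apply: hzo; exact: open_nbhs_nbhs.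
apply: (WW' (act h (z (maxn M N))) (act h (z N))) => //; try exact: Dhz.
  by apply: MW; exact: leq_maxl.
by apply: constant; exact: leq_maxr.
Qed.

End stability.
End group_actions.

(** * Essentially countable orbit equivalence relations *)

(** Moving the target to a Polish space [P] keeps all that the category
    argument needs from a reduction: arguments with equal values are
    equivalent, and each class has countably many values. *)
Lemma standard_borel_reduction (R : realType) d (X : measurableType d)
    (E : X -> X -> Prop) :
  essentially_countable R E ->
  exists P : ptopologicalType, polish R P /\
  exists f : X -> borelType P, [/\ measurable_fun setT f,
    forall x x', f x = f x' -> E x x' &
    forall x, countable [set f x' | x' in [set x' | E x x']]].
Proof.
move=> [d' [Y [F [[P polP [u [v [uv _ mu _]]]] [eqF _ cntF] [f mf fE]]]]].
exists P; split=> //; exists (u \o f); split.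
- exact: measurableT_comp.
- move=> x x' /(congr1 v) /=; rewrite !uv => ff.
  by apply/fE; rewrite ff; apply: RelationClasses.Equivalence_Reflexive.
- move=> x; apply: sub_countable (cntF (f x)).
  apply: card_le_trans (card_image_le u _).
  apply: subset_card_le => _ [x' /fE Fx <-].
  by exists (f x').
Qed.

Theorem theorem4p1 (R : realType) (G : topologicalGroupType)
    (X : ptopologicalType) (act : G -> X -> X)
    (polishG : polish R G) (polishX : polish_G_space R act)
    (approx : forall (V : set G) (C O : set X),
      open V -> V 1%g ->
      act_invariant act C -> comeager C ->
      ~ meager O ->
      exists c o, [/\ C c, O o, V_approx act V c o &
                      act_orbit act c <> act_orbit act o]) :
  ~ essentially_countable R (orbit_equiv act : borelType X -> borelType X -> Prop).
Proof.
move=> /standard_borel_reduction[P [polP [f [mf fE cntf]]]].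
have [polX act_cont] := polishX.
have [BG baseG] := polish_countable_base polishG.
have [BP baseP] := polish_countable_base polP.
have [baireG baireX] := (polish_baire polishG, polish_baire polX).
have hausP := polish_hausdorff polP.
have [D cD fD] := borel_continuous_comeager baseP mf.
have cnt x : countable (range (fun g => f (act g x))).
  apply: sub_countable (cntf x); apply: subset_card_le => _ [g _ <-].
  by exists (act g x) => //; apply/orbit_equivP => //; exists g.
have [|V [U [oV V1 oU U0 UV]]] :=
  locally_stable act_cont hausP fD baireG baseG baireX _ cD cnt.
  by exists point.
have cC := vaught_star_comeager act_cont baseG cD.
have oV' : open [set g : G | V g^-1%g].
  apply: (@open_comp _ _ (fun g : G => g^-1%g)) => // g _.
  exact: invg_continuous.
have V'1 : V (1^-1)%g by rewrite invg1.
have [c [y [Cc [Uy Cy] cy neq]]] := approx _ _ _ oV' V'1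
  (vaught_star_invariant act_cont (D := D)) cC (open_nonmeager baireX oU U0 cC).
apply: neq; have [g [h /fE fgh]] :=
  approx_common_value act_cont hausP fD baireG oV V1 oU UV Cc Cy Uy cy.
have orb k x : act_orbit act (act k x) = act_orbit act x.
  by symmetry; apply/orbit_equivP => //; exists k.
by move: fgh; rewrite /orbit_equiv !orb.
Qed.
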